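(* Let $R$ and $R'$ be finite unital rings and suppose that there is a ring homomorphism $\Phi\colon R\to R'$. If $R$ has the $2$-sum property, then so does $R'$.
   Context: Rings are finite, unital, with $0\neq 1$, not necessarily commutative; ring homomorphisms preserve $1$. A ring $R$ has the $n$-sum property if every element of $R$ can be written as the sum of exactly $n$ elements of the unit group $R^\times$. *)

(* Defs.v *)
From HB Require Import structures.
From mathcomp Require Import all_boot all_order all_algebra.

Set Implicit Arguments.
Unset Strict Implicit.
Unset Printing Implicit Defensive.

Import GRing.Theory.
Local Open Scope ring_scope.

(* [finUnitRingType] adds no assumption to "finite unital ring with 0 != 1":
   [GRing.unit] is axiomatized to be exactly the set of two-sided invertible
   elements, and finite rings always carry this structure (see [finalg]). *)
Definition n_sum_property (R : finUnitRingType) (n : nat) : Prop :=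
  forall x : R, exists u : 'I_n -> R,
    (forall i : 'I_n, u i \is a GRing.unit) /\ x = \sum_(i < n) u i.

(* Main.v *)
Require Import Defs.
From HB Require Import structures.
From mathcomp Require Import all_boot all_order all_algebra.

Set Implicit Arguments.
Unset Strict Implicit.
Unset Printing Implicit Defensive.

Import GRing.Theory.
Local Open Scope ring_scope.

(** Writing [1 = u + v] with units of [R] and applying [Phi] gives a
    decomposition of the same kind in [R'], so it suffices to show that in
    a finite ring where 1 is a sum of two units, every element is.  Conceptually, modulo its radical a finite ring is a product of
    matrix rings over finite fields; the only factor which is not 2-good (that
    is, in which some element is not a sum of two units) is the field of two
    elements, and [u + v = 1] excludes it because 1 + 1 = 0 there.

    The proof follows this idea with idempotents only, avoiding quotients and
    the Artin-Wedderburn theorem.  An element of a corner ring [gRg] with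
    [g = e + h] (orthogonal idempotents) is a 2 x 2 matrix for the Peirce
    decomposition.  If its diagonal entries are sums of two units, then so is
    the matrix, as the sum of a lower and an upper triangular one
    ([two_sum_block]).  Thus the idempotents [h] with [hRh] 2-good can be
    enlarged by adding 2-good orthogonal pieces.

    To enlarge [h <> 1], take a primitive idempotent [e] below [1 - h]; then
    [eRe] is local.  Since [e = e u e u^-1 e + e u (1 - e) u^-1 e], either
    [e u e] is a unit of [eRe], or [e] factors as [a * b] with [a] in
    [eR(1 - e)] and [b] in [(1 - e)Re] ([local_unit_or_split]); likewise for
    [v].

    - If both [e u e] and [e v e] are units of [eRe], their sum is [e], the
      residue field of [eRe] has an element other than 0 and 1, and [eRe] is
      2-good ([local_two_good]).
    - If [e = a * b], split [1 - e] as [h + g]; by locality the factorization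
      can be moved into [h] or into [g].  In the first case [e] is isomorphic to
      an idempotent below [h]; column operations clear the [e]-entry of a matrix
      over [e + h] unless that entry is already a sum of two units, so the
      corner of [e + h] is 2-good ([two_good_absorb]).  In
      the second case [k = b * a] is a copy of [e] orthogonal to [e] and [h];
      the corner of [e + k] is a ring of 2 x 2 matrices over a local ring,
      which is always 2-good ([two_good_mx2]), and it is added to [h].

    Finiteness gives primitive idempotents, the locality of their corners (some
    power of each element is idempotent) and the termination of the
    enlargement. *)

(** * Peirce components and units of corner rings *)

Section Peirce.
Variable R : pzRingType.
Implicit Types e f g h x y z a b c t u v : R.

Definition peirce e f x := e * x = x /\ x * f = x.

Lemma peirceD e f x y : peirce e f x -> peirce e f y -> peirce e f (x + y).
Proof.
by move=> [ex xf] [ey yf]; split; rewrite ?mulrDr ?mulrDl ?ex ?ey ?xf ?yf.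
Qed.

Lemma peirceN e f x : peirce e f x -> peirce e f (- x).
Proof. by move=> [ex xf]; split; rewrite ?mulrN ?mulNr ?ex ?xf. Qed.

Lemma peirceB e f x y : peirce e f x -> peirce e f y -> peirce e f (x - y).
Proof. by move=> ? ?; apply: peirceD => //; apply: peirceN. Qed.

Lemma peirceM e f g x y : peirce e f x -> peirce f g y -> peirce e g (x * y).
Proof. by move=> [ex _] [_ yg]; split; rewrite ?mulrA ?ex // -mulrA yg. Qed.

Lemma peirce_mul0 e f f' g x y :
  f * f' = 0 -> peirce e f x -> peirce f' g y -> x * y = 0.
Proof. by move=> ff' [_ <-] [<- _]; rewrite mulrA -(mulrA x) ff' mulr0 mul0r. Qed.

Lemma peirce_proj e f x : e * e = e -> f * f = f -> peirce e f (e * x * f).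
Proof. by move=> ee ff; split; rewrite ?mulrA ?ee // -mulrA ff. Qed.

Lemma peirce_idem e : e * e = e -> peirce e e e.
Proof. by []. Qed.

(** One-sided inverses suffice: they are stable under products, and in the
    whole finite ring they are two-sided ([right_inverse_unit]). *)
Definition corner_unit g u :=
  peirce g g u /\ exists2 v, peirce g g v & u * v = g.

Lemma corner_unit_idem g : g * g = g -> corner_unit g g.
Proof. by move=> gg; split; [split | exists g; [split |]]. Qed.

Lemma corner_unitN g u : corner_unit g u -> corner_unit g (- u).
Proof.
move=> [Pu [v Pv uv]]; split; first exact: peirceN.
by exists (- v); rewrite ?mulrNN //; apply: peirceN.
Qed.

Lemma corner_unitM g u v :
  corner_unit g u -> corner_unit g v -> corner_unit g (u * v).
Proof.
move=> [Pu [u' Pu' uu']] [Pv [v' Pv' vv']]; split; first exact: peirceM Pv.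
exists (v' * u'); first exact: peirceM Pu'.
by rewrite mulrA -(mulrA u) vv' (proj2 Pu).
Qed.

Definition two_sum g x :=
  exists u v, [/\ corner_unit g u, corner_unit g v & x = u + v].

Definition two_good g := forall x, peirce g g x -> two_sum g x.

Lemma two_sumMl g w x : corner_unit g w -> two_sum g x -> two_sum g (w * x).
Proof.
move=> Uw [u [v [Uu Uv ->]]]; exists (w * u), (w * v).
by split; [apply: corner_unitM | apply: corner_unitM | rewrite mulrDr].
Qed.

Lemma two_sumMr g w x : corner_unit g w -> two_sum g x -> two_sum g (x * w).
Proof.
move=> Uw [u [v [Uu Uv ->]]]; exists (u * w), (v * w).
by split; [apply: corner_unitM | apply: corner_unitM | rewrite mulrDl].
Qed.

Lemma two_sum_near g x : g * g = g -> corner_unit g (g - x) -> two_sum g x.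
Proof.
move=> gg Ux; exists g, (- (g - x)); split; first exact: corner_unit_idem.
  exact: corner_unitN.
by rewrite opprB addrC subrK.
Qed.

(** The matrices of row and column operations: the inverse of [g - c] is
    [g + c]. *)
Lemma corner_unit_elementary g c :
  g * g = g -> peirce g g c -> c * c = 0 -> corner_unit g (g - c).
Proof.
move=> gg Pc cc; split; first exact: peirceB.
exists (g + c); first exact: peirceD.
by case: Pc => gc cg; rewrite mulrBl !mulrDr gg gc cg cc addr0 addrK.
Qed.

Lemma two_sum_row_op g c x : g * g = g -> peirce g g c -> c * c = 0 ->
  peirce g g x -> two_sum g (x + c * x) -> two_sum g x.
Proof.
move=> gg Pc cc Px /(two_sumMl (corner_unit_elementary gg Pc cc)).
rewrite mulrBl !mulrDr !mulrA (proj1 Px) (proj1 Pc) cc mul0r addr0.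
by rewrite addrK.
Qed.

Lemma two_sum_col_op g c x : g * g = g -> peirce g g c -> c * c = 0 ->
  peirce g g x -> two_sum g (x + x * c) -> two_sum g x.
Proof.
move=> gg Pc cc Px /(two_sumMr (corner_unit_elementary gg Pc cc)).
rewrite mulrBr !mulrDl -!mulrA (proj2 Px) (proj2 Pc) cc mulr0 addr0.
by rewrite addrK.
Qed.

(** * Two by two Peirce matrices *)

Definition orthogonal e h := [/\ e * e = e, h * h = h, e * h = 0 & h * e = 0].

Lemma orthogonal_sym e h : orthogonal e h -> orthogonal h e.
Proof. by case. Qed.

Lemma orthogonal_idemD e h : orthogonal e h -> (e + h) * (e + h) = e + h.
Proof. by case=> ee hh eh he; rewrite mulrDl !mulrDr ee hh eh he addr0 add0r. Qed.

Lemma peirceWl e h f x : orthogonal e h -> peirce e f x -> peirce (e + h) f x.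
Proof.
case=> _ _ _ he [ex xf]; split=> //.
by rewrite mulrDl ex -ex mulrA he mul0r addr0.
Qed.

Lemma peirceWr e h f x : orthogonal e h -> peirce f e x -> peirce f (e + h) x.
Proof.
case=> _ _ eh _ [fx xe]; split=> //.
by rewrite mulrDr xe -xe -mulrA eh mulr0 addr0.
Qed.

Lemma peirceW_upper e h c :
  orthogonal e h -> peirce e h c -> peirce (e + h) (e + h) c.
Proof.
by move=> O Pc; apply: peirceWl => //; rewrite addrC; apply: peirceWr;
   first exact: orthogonal_sym.
Qed.

Lemma peirceW_lower e h c :
  orthogonal e h -> peirce h e c -> peirce (e + h) (e + h) c.
Proof. by move=> O; rewrite addrC; apply/peirceW_upper/orthogonal_sym. Qed.

Lemma peirceDE e h x : peirce (e + h) (e + h) x ->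
  x = e * x * e + e * x * h + (h * x * e + h * x * h).
Proof. by move=> [gx xg]; rewrite -!mulrDr -!mulrDl gx xg. Qed.

(** A lower triangular matrix with unit diagonal entries has the inverse
    [[p', 0], [- q' c p', q']]. *)
Lemma corner_unit_triangular e h p q c : orthogonal e h ->
  corner_unit e p -> corner_unit h q -> peirce h e c ->
  corner_unit (e + h) (p + q + c).
Proof.
move=> O [Pp [p' Pp' pp']] [Pq [q' Pq' qq']] Pc.
have O' := orthogonal_sym O; have [ee hh eh he] := O.
have W x : peirce e e x -> peirce (e + h) (e + h) x.
  by move=> Px; apply: peirceWl => //; apply: peirceWr.
have W' x : peirce h h x -> peirce (e + h) (e + h) x.
  by move=> Px; rewrite addrC; apply: peirceWl => //; apply: peirceWr.
have Wc x : peirce h e x -> peirce (e + h) (e + h) x.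
  exact: peirceW_lower.
have Pd : peirce h e (q' * c * p') by apply: peirceM Pp'; apply: peirceM Pc.
split.
  by apply: peirceD; [apply: peirceD; [exact: W | exact: W'] | exact: Wc].
exists (p' + q' - q' * c * p').
  by apply: peirceB; [apply: peirceD; [exact: W | exact: W'] | exact: Wc].
rewrite !mulrDl !mulrBr !mulrDr pp' qq'.
rewrite (peirce_mul0 eh Pp Pq') (peirce_mul0 eh Pp Pd) (peirce_mul0 he Pq Pp').
rewrite (peirce_mul0 eh Pc Pq') (peirce_mul0 eh Pc Pd) !mulrA qq'.
by rewrite (proj1 Pc) !(addr0, add0r, subr0) -addrA subrK.
Qed.

(** Write the diagonal entries as [u1 + v1] and [u2 + v2], and let the first
    unit take the entry below the diagonal and the second the one above; the
    two summands are triangular. *)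
Lemma two_sum_block e h x : orthogonal e h -> peirce (e + h) (e + h) x ->
  two_sum e (e * x * e) -> two_sum h (h * x * h) -> two_sum (e + h) x.
Proof.
move=> O Px [u1 [v1 [U1 V1 x1]]] [u2 [v2 [U2 V2 x2]]].
have [ee hh _ _] := O.
exists (u1 + u2 + h * x * e), (v2 + v1 + e * x * h); split.
- by apply: corner_unit_triangular => //; apply: peirce_proj.
- rewrite addrC; apply: corner_unit_triangular => //.
  + exact: orthogonal_sym.
  + exact: peirce_proj.
rewrite [LHS](peirceDE Px) x1 x2.
by rewrite [RHS](AC (3*3) (1*5*6*(3*(2*4)))).
Qed.

Lemma two_good_block e h :
  orthogonal e h -> two_good e -> two_good h -> two_good (e + h).
Proof.
move=> O Te Th x Px; have [ee hh _ _] := O.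
by apply: two_sum_block => //; [apply: Te | apply: Th]; apply: peirce_proj.
Qed.

(** Locality of [eRe] in the form in which it is used: a sum of two elements
    equal to [e] has an invertible term. *)
Definition local_corner e :=
  forall t, peirce e e t -> corner_unit e t \/ corner_unit e (e - t).

(** The hypothesis on [t] says that the residue field of [eRe] is not the
    field of two elements.  A unit [x] is [x t + x (e - t)], and a non-unit is
    [e - (e - x)]. *)
Lemma local_two_good e t : e * e = e -> local_corner e ->
  corner_unit e t -> corner_unit e (e - t) -> two_good e.
Proof.
move=> ee Le Ut Ut' x Px; have [Ux | Ux] := Le x Px; last exact: two_sum_near.
exists (x * t), (x * (e - t)); split; try exact: corner_unitM.
by rewrite -mulrDr addrC subrK (proj2 Px).
Qed.

Lemma sub_orthogonal_sq0 e h c : orthogonal e h -> peirce e h c -> c * c = 0.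
Proof. by case=> _ _ _ he Pc; apply: (peirce_mul0 he Pc Pc). Qed.

(** The factorization [e = a * b] allows the upper left entry to be replaced
    by 0.  If that entry, [x11], is not a unit of the local ring [eRe], then it
    is already a sum of two units.  If it is, a first column operation turns
    [x12] into an entry [y] with [y * b = x11], and subtracting the second
    column times [b] from the first then clears the corner. *)
Lemma clear_corner e h a b x : orthogonal e h -> local_corner e ->
  peirce e h a -> peirce h e b -> a * b = e ->
  (forall z, peirce (e + h) (e + h) z -> two_sum e (e * z * e) ->
     two_sum (e + h) z) ->
  peirce (e + h) (e + h) x -> two_sum (e + h) x.
Proof.
move=> O Le Pa Pb ab IH Px; have O' := orthogonal_sym O.
have [ee hh eh he] := O; have gg := orthogonal_idemD O.
have Pxe : peirce e e (e * x * e) by apply: peirce_proj.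
have [[_ [y Py xy]] | Ux] := Le _ Pxe; last first.
  by apply: IH => //; apply: two_sum_near.
have Weh c : peirce e h c -> peirce (e + h) (e + h) c.
  exact: peirceW_upper.
have Whe c : peirce h e c -> peirce (e + h) (e + h) c.
  exact: peirceW_lower.
(* [k] is chosen so that (x12 + x11 k a) b = x12 b + x11 k = x11. *)
have [k Pk kE] : exists2 k, peirce e e k &
    e * x * e * k = e * x * e - e * x * b.
  exists (y * (e * x * e - e * x * b)).
    apply: (peirceM Py); apply: peirceB => //; split; first by rewrite !mulrA ee.
    by rewrite -mulrA (proj2 Pb).
  by rewrite mulrA xy mulrBr !mulrA !ee.
have xk : e * (x * k) = e * (x * e) - e * (x * b).
  by rewrite -(proj1 Pk) !mulrA kE.
have Pka : peirce e h (k * a) by apply: peirceM Pa.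
apply: (two_sum_col_op gg (Weh _ Pka)) => //.
  exact: sub_orthogonal_sq0 Pka.
have Px' : peirce (e + h) (e + h) (x + x * (k * a)).
  by apply: peirceD => //; apply: peirceM Px _; apply: Weh.
have Pb' := peirceN Pb.
apply: (two_sum_col_op gg (Whe _ Pb')) => //.
  exact: sub_orthogonal_sq0 Pb'.
apply: IH.
  by apply: peirceD => //; apply: peirceM Px' _; apply: Whe.
suff -> : e * (x + x * (k * a) + (x + x * (k * a)) * - b) * e = 0.
  exists e, (- e); split; rewrite ?subrr //; first exact: corner_unit_idem.
  exact/corner_unitN/corner_unit_idem.
have ae : a * e = 0 by rewrite -(proj2 Pa) -mulrA he mulr0.
rewrite mulrN mulrBr mulrBl -!mulrA (proj2 Pb).
rewrite !(mulrDr, mulrDl) -!mulrA ae ab (proj2 Pk) !mulr0 addr0.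
by rewrite xk [e * (x * b) + _]addrC subrK subrr.
Qed.

Lemma two_good_absorb e h a b : orthogonal e h -> local_corner e ->
  peirce e h a -> peirce h e b -> a * b = e -> two_good h -> two_good (e + h).
Proof.
move=> O Le Pa Pb ab Th x; apply: (clear_corner O Le Pa Pb ab) => z Pz Te.
by apply: two_sum_block => //; apply: Th; case: O => *; apply: peirce_proj.
Qed.

(** With [e] and [h] identified through [a] and [b], this is the decomposition
      [[0, y], [1, w]] = [[1, y + w], [0, 1]] + [[-1, -w], [1, w - 1]],
    in which the last matrix is [[1, 0], [-1, 1]] * [[-1, -w], [0, -1]] and so
    is invertible. *)
Lemma two_sum_antidiagonal e h a b x : orthogonal e h ->
  peirce e h a -> peirce h e b -> b * a = h ->
  peirce (e + h) (e + h) x -> e * x * e = 0 -> h * x * e = b ->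
  two_sum (e + h) x.
Proof.
move=> O Pa Pb ba Px x11 x21; have O' := orthogonal_sym O.
have [ee hh eh he] := O.
have Pw : peirce h h (h * x * h) by apply: peirce_proj.
have Paw : peirce e h (a * (h * x * h)) by apply: peirceM Pw.
exists (h + e + (a * (h * x * h) + e * x * h)).
exists ((e + h - b) * (- h + - e - a * (h * x * h))); split.
- rewrite addrC.
  apply: corner_unit_triangular => //; try exact: corner_unit_idem.
  by apply: peirceD => //; apply: peirce_proj.
- apply: corner_unitM.
    apply: corner_unit_triangular => //; try exact: corner_unit_idem.
    exact: peirceN.
  rewrite addrC.
  apply: corner_unit_triangular => //; last exact: peirceN.
    exact/corner_unitN/corner_unit_idem.
  exact/corner_unitN/corner_unit_idem.
rewrite [LHS](peirceDE Px) x11 x21.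
move: Pw Paw; set w := h * x * h; set y := e * x * h.
move: w y => w y Pw Paw.
have hy : h * (a * w) = 0 by exact: peirce_mul0 he (peirce_idem hh) Paw.
have bh : b * h = 0 by rewrite -(proj2 Pb) -mulrA eh mulr0.
rewrite !mulrDl !mulrDr !mulNr !mulrN !opprK eh ee hh he (proj1 Paw) hy bh (proj2 Pb).
rewrite mulrA ba (proj1 Pw) !oppr0 !(addr0, add0r).
rewrite !addrA; congr (_ + _); congr (_ + _).
by rewrite [RHS](ACl (4*((1*7)*((2*5)*(3*6))))) /= !subrr !addr0.
Qed.

(** The corner of [e + h] is here the ring of 2 x 2 matrices over the local
    ring [eRe].  By [clear_corner] the upper left entry may be taken to be a sum
    of two units.  If the lower right entry [w] is not a unit, both diagonal
    entries are sums of two units.  If it is, a column operation makes the lower left entry 1, a row operation then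
    clears the upper left one, and [two_sum_antidiagonal] applies. *)
Lemma two_good_mx2 e h a b : orthogonal e h -> local_corner e ->
  peirce e h a -> peirce h e b -> a * b = e -> b * a = h -> two_good (e + h).
Proof.
move=> O Le Pa Pb ab ba x; apply: (clear_corner O Le Pa Pb ab) => z Pz Te.
have O' := orthogonal_sym O.
have [ee hh eh he] := O; have gg := orthogonal_idemD O.
(* Conjugation by [a] and [b] transports locality from [eRe] to [hRh]. *)
have Lh w : peirce h h w -> corner_unit h w \/ corner_unit h (h - w).
  move=> Pw.
  have lift w' : peirce h h w' -> corner_unit e (a * w' * b) -> corner_unit h w'.
    move=> Pw' [_ [p Pp pE]]; split=> //.
    exists (b * p * a); first by apply: peirceM Pa; apply: peirceM Pp.
    rewrite -(proj1 Pw') -{1}ba.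
    have -> : b * a * w' * (b * p * a) = b * (a * w' * b * p) * a.
      by rewrite !mulrA.
    by rewrite pE (proj2 Pb).
  have [U|U] := Le (a * w * b) (peirceM (peirceM Pa Pw) Pb).
    by left; apply: lift.
  right; apply: lift; first exact: peirceB.
  by rewrite mulrBr mulrBl (proj2 Pa) ab.
have Pw : peirce h h (h * z * h) by apply: peirce_proj.
have [[_ [w' Pw' ww']] | Uw] := Lh _ Pw; last first.
  by apply: two_sum_block => //; apply: two_sum_near.
have Weh c : peirce e h c -> peirce (e + h) (e + h) c.
  exact: peirceW_upper.
have Whe c : peirce h e c -> peirce (e + h) (e + h) c.
  exact: peirceW_lower.
pose c := w' * (b - h * z * e).
have Pc : peirce h e c.
  by apply: (peirceM Pw'); apply: peirceB => //; apply: peirce_proj.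
apply: (two_sum_col_op gg (Whe _ Pc)) => //; first exact: sub_orthogonal_sq0 Pc.
set z1 := z + z * c.
have Pz1 : peirce (e + h) (e + h) z1.
  by apply: peirceD => //; apply: peirceM Pz _; apply: Whe.
have z1_21 : h * z1 * e = b.
  rewrite mulrDr mulrDl -(mulrA h (z * c)) -(mulrA z) (proj2 Pc).
  rewrite -{1}(proj1 Pc) !mulrA -(mulrA (h * z * h)) mulrA ww'.
  by rewrite mulrBr (proj1 Pb) !mulrA hh addrC subrK.
clearbody z1.
have [d Pd db] : exists2 d, peirce e h d & d * b = - (e * z1 * e).
  exists (- (e * z1 * e * a)).
    by apply: peirceN; apply: peirceM Pa; apply: peirce_proj.
  by rewrite mulNr -(mulrA _ a) ab -mulrA ee.
apply: (two_sum_row_op gg (Weh _ Pd)) => //; first exact: sub_orthogonal_sq0 Pd.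
apply: (two_sum_antidiagonal O Pa Pb ba).
- by apply: peirceD => //; apply: peirceM Pz1; apply: Weh.
- rewrite mulrDr mulrDl mulrA (proj1 Pd) -(proj2 Pd) -(mulrA d).
  by rewrite -[d * _ * e]mulrA z1_21 db subrr.
rewrite mulrDr mulrDl !mulrA.
by rewrite (peirce_mul0 he (peirce_idem hh) Pd) !mul0r addr0.
Qed.


(** * Enlarging a 2-good corner *)

Lemma corner_unit_factor e g a b : peirce e g a -> peirce g e b ->
  corner_unit e (a * b) -> exists2 b', peirce g e b' & a * b' = e.
Proof.
by move=> Pa Pb [_ [q Pq abq]]; exists (b * q);
   [apply: peirceM Pq | rewrite mulrA].
Qed.

Lemma orthogonal_compl e : e * e = e -> orthogonal e (1 - e).
Proof.
by move=> ee; split; rewrite ?mulrBr ?mulrBl ?mulr1 ?mul1r ?ee ?subrr ?subr0.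
Qed.

(** The element [e u u' e = e] is the sum of [(e u e) (e u' e)] and
    [(e u (1 - e)) ((1 - e) u' e)], and by locality one of the two products is
    a unit of [eRe].  If the residue field of [eRe] has two elements, the first
    alternative cannot hold for both terms of a decomposition [1 = u + v] into
    units; this is where that decomposition rules out a quotient of two
    elements. *)
Lemma local_unit_or_split e u u' : e * e = e -> local_corner e -> u * u' = 1 ->
  corner_unit e (e * u * e) \/
  exists a b, [/\ peirce e (1 - e) a, peirce (1 - e) e b & a * b = e].
Proof.
move=> ee Le uu'; have [_ ff _ _] := orthogonal_compl ee.
have PM f : f * f = f -> e * u * f * (f * u' * e) = e * u * f * u' * e.
  by move=> fE; rewrite !mulrA -(mulrA (e * u) f f) fE.
have Pl f : f * f = f -> peirce e f (e * u * f) by apply: peirce_proj.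
have Pr f : f * f = f -> peirce f e (f * u' * e) by move=> ?; apply: peirce_proj.
have [U|U] := Le _ (peirceM (Pl e ee) (Pr e ee)).
  left; split; first exact: Pl.
  exact: corner_unit_factor (Pl e ee) (Pr e ee) U.
right; exists (e * u * (1 - e)).
have [|b Pb ab] := corner_unit_factor (Pl _ ff) (Pr _ ff).
  move: U; rewrite !PM // mulrBr mulr1 mulrBl mulrBl -(mulrA e u u') uu'.
  by rewrite mulr1 ee.
by exists b; split=> //; apply: Pl.
Qed.

(** The step of the induction.  The equation [k * e = e] records that [k] is
    strictly larger than [h] when [e] is nonzero. *)
Lemma two_good_extend_local e h u u' v v' : orthogonal e h -> local_corner e ->
  u * u' = 1 -> v * v' = 1 -> u + v = 1 -> two_good h ->
  exists k, [/\ k * k = k, peirce k k h, k * e = e & two_good k].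
Proof.
move=> O Le uu' vv' uv Th; have [ee hh eh he] := O.
have Pk : peirce (e + h) (e + h) h.
  by split; rewrite ?mulrDl ?mulrDr ?eh ?he hh add0r.
have eehe : (e + h) * e = e by rewrite mulrDl ee he addr0.
have gg := orthogonal_idemD O.
have O1 := orthogonal_compl ee; have [_ ff _ _] := O1.
have split_case a b : peirce e (1 - e) a -> peirce (1 - e) e b -> a * b = e ->
    exists k, [/\ k * k = k, peirce k k h, k * e = e & two_good k].
  move=> Pa Pb ab; pose g := 1 - e - h.
  have Ph : peirce (1 - e) (1 - e) h.
    by split; rewrite ?mulrBl ?mulrBr ?mul1r ?mulr1 ?eh ?he subr0.
  have Pg : peirce (1 - e) (1 - e) g by apply: peirceB.
  have gE : 1 - e = h + g by rewrite /g [h + _]addrC subrK.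
  have [hg gh] : h * g = 0 /\ g * h = 0.
    by split; rewrite /g ?mulrBr ?mulrBl ?mulr1 ?mul1r ?eh ?he hh subr0 subrr.
  have [eg ge] : e * g = 0 /\ g * e = 0.
    by split; rewrite /g ?mulrBr ?mulrBl ?mulr1 ?mul1r ?eh ?he ee subr0 subrr.
  have g2 : g * g = g by rewrite {1}/g !mulrBl mul1r eg hg !subr0.
  clearbody g.
  have Pah f : f * f = f -> peirce e f (a * f).
    by move=> fE; split; rewrite ?mulrA ?(proj1 Pa) // -mulrA fE.
  have Phb f : f * f = f -> peirce f e (f * b).
    by move=> fE; split; rewrite ?mulrA ?fE // -mulrA (proj2 Pb).
  have [U|U] := Le _ (peirceM (Pah h hh) (Phb h hh)).
    have [b' Pb' ab'] := corner_unit_factor (Pah h hh) (Phb h hh) U.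
    exists (e + h); split=> //.
    exact: two_good_absorb O Le (Pah h hh) Pb' ab' Th.
  have [|b' Pb' ab'] := corner_unit_factor (Pah g g2) (Phb g g2).
    suff <- : e - a * h * (h * b) = a * g * (g * b) by [].
    rewrite !mulrA -(mulrA a h h) hh -(mulrA a g g) g2.
    by rewrite -{1}ab -{1}(proj2 Pa) gE mulrDr mulrDl addrC addKr.
  (* [b' * a'] is an idempotent of [gRg] isomorphic to [e]. *)
  move: (a * g) (Pah g g2) ab' => a' Pa' ab'.
  have Pk' : peirce g g (b' * a') by apply: peirceM Pa'.
  have kk : b' * a' * (b' * a') = b' * a'.
    by rewrite !mulrA -(mulrA b') ab' (proj2 Pb').
  have Oe : orthogonal e (b' * a').
    split=> //; first exact: (peirce_mul0 eg (peirce_idem ee) Pk').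
    exact: (peirce_mul0 ge Pk' (peirce_idem ee)).
  have Oh : orthogonal h (e + b' * a').
    split=> //; first exact: orthogonal_idemD.
      by rewrite mulrDr he (peirce_mul0 hg (peirce_idem hh) Pk') addr0.
    by rewrite mulrDl eh (peirce_mul0 gh Pk' (peirce_idem hh)) addr0.
  exists (h + (e + b' * a')); have [_ _ hk kh] := Oh; split.
  - exact: orthogonal_idemD.
  - by split; [rewrite mulrDl hh kh addr0 | rewrite mulrDr hh hk addr0].
  - have [_ _ _ ke] := Oe.
    by rewrite !mulrDl he ee ke addr0 add0r.
  apply: two_good_block => //.
  apply: (@two_good_mx2 e _ a' b') => //.
    by split; [case: Pa' | rewrite mulrA ab'; case: Pa'].
  by split; [rewrite -mulrA ab'; case: Pb' | case: Pb'].
have [Uu|] := local_unit_or_split ee Le uu'; last first.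
  by case=> a [b [*]]; apply: (split_case a b).
have [Uv|] := local_unit_or_split ee Le vv'; last first.
  by case=> a [b [*]]; apply: (split_case a b).
exists (e + h); split=> //; apply: two_good_block => //.
apply: (local_two_good ee Le Uu).
suff -> : e - e * u * e = e * v * e by [].
by rewrite -{1}ee -{1}[e]mulr1 -uv mulrDr mulrDl addrC addKr.
Qed.

End Peirce.

(** * Finite rings *)

Section Finite.
Variable R : finNzRingType.
Implicit Types e f g h t : R.

(** The powers of [t] are eventually periodic, and a power whose exponent is a
    multiple of the period beyond the preperiod is idempotent.  An exponent at
    least 2 lets [t] be split off from that power, leaving a factor that is
    still a positive power of [t]. *)
Lemma idempotent_power t : exists k, t ^+ k.+2 * t ^+ k.+2 = t ^+ k.+2.
Proof.
have /injectivePn [i [j ij tij]] : ~~ injectiveb (fun i : 'I_#|R|.+1 => t ^+ i).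
  apply/injectiveP => /leq_card; by rewrite card_ord ltnn.
wlog lt_ij : i j ij tij / (i < j)%N.
  move=> H; have [lt|lt|/val_inj eq_ij] := ltngtP i j.
  - exact: H lt.
  - by apply: (H j i); rewrite // eq_sym.
  - by rewrite eq_ij eqxx in ij.
have shift m d : t ^+ (i + m + d * (j - i)) = t ^+ (i + m).
  elim: d => [|d IH]; first by rewrite addn0.
  rewrite mulSn [(_ + d * _)%N]addnC addnA exprD IH -exprD -addnA.
  by rewrite [(m + _)%N]addnC addnA subnKC ?(ltnW lt_ij) // exprD -tij -exprD.
pose n := ((i.+2) * (j - i))%N.
have ji : (0 < j - i)%N by rewrite subn_gt0.
have le_in : (i.+2 <= n)%N by rewrite leq_pmulr.
exists n.-2; have -> : n.-2.+2 = n by case: n le_in => [|[|]].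
have nE : (n = i + (n - i))%N by rewrite subnKC // ltnW // ltnW.
by rewrite -exprD {1}nE shift -nE.
Qed.

(** Some power of [t] is an idempotent of [eRe], hence [e] or 0 by minimality:
    either [t] is a unit, or it is nilpotent and the geometric sum inverts
    [e - t]. *)
Lemma minimal_local_corner e : e * e = e ->
  (forall e', peirce e e e' -> e' * e' = e' -> e' = 0 \/ e' = e) ->
  local_corner e.
Proof.
move=> ee min t Pt; have [k kk] := idempotent_power t.
have PX n : peirce e e (t ^+ n.+1).
  by split; [rewrite exprS mulrA (proj1 Pt) | rewrite exprSr -mulrA (proj2 Pt)].
have [t0 | te] := min _ (PX _) kk; last first.
  by left; split=> //; exists (t ^+ k.+1) => //; rewrite -exprS.
right; split; first exact: peirceB.
exists (e * (\sum_(i < k.+2) t ^+ i) * e); first exact: peirce_proj.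
have -> : e - t = e * (1 - t) by rewrite mulrBr mulr1 (proj1 Pt).
have et : e * (1 - t) * e = e * (1 - t).
  by rewrite mulrBr mulrBl mulr1 (proj1 Pt) (proj2 Pt) ee.
rewrite !mulrA et -(mulrA e (1 - t)).
have -> : (1 - t) * (\sum_(i < k.+2) t ^+ i) = 1.
  by rewrite -[LHS]opprK -mulNr opprB -subrX1 t0 sub0r opprK.
by rewrite mulr1.
Qed.

(** A nonzero idempotent below [f] with the smallest right ideal [eR] is
    primitive. *)
Lemma exists_local_corner f : f * f = f -> f != 0 ->
  exists e, [/\ e * e = e, e != 0, peirce f f e & local_corner e].
Proof.
move=> ff f0.
pose P e := [&& e * e == e, e != 0, f * e == e & e * f == e].
have Pf : P f by rewrite /P ff f0 !eqxx.
case: (arg_minnP (fun e => #|[set x : R | e * x == x]|) Pf).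
move=> e /and4P[/eqP ee e0 /eqP fe /eqP ef] min.
exists e; split=> //; apply: minimal_local_corner => // e' [ee' e'e] e'2.
have [->|e'0] := eqVneq e' 0; [by left | right].
have Pe' : P e'.
  have fe' : f * e' = e' by rewrite -ee' mulrA fe.
  have e'f : e' * f = e' by rewrite -e'e -mulrA ef.
  by rewrite /P e'2 e'0 fe' e'f !eqxx.
(* Otherwise [e'R] is properly contained in [eR], as it does not contain [e]. *)
apply/eqP/negPn/negP => ne; have := min e' Pe'; rewrite leqNgt => /negP; apply.
apply: proper_card; apply/properP; split.
  by apply/subsetP => x; rewrite !inE => /eqP <-; rewrite mulrA ee'.
by exists e; rewrite !inE ?ee // e'e.
Qed.

(** Induction on the size of [(1 - h)R], starting from the zero corner, whose
    only element is its own unit. *)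
Lemma two_good1 (u u' v v' : R) : u * u' = 1 -> v * v' = 1 -> u + v = 1 ->
  two_good (1 : R).
Proof.
move=> uu' vv' uv.
have main n h : (#|[set x : R | (1 - h) * x == x]%R| <= n)%N -> h * h = h ->
    two_good h -> two_good (1 : R).
  elim: n h => [|n IH] h.
    rewrite leqn0 cards_eq0 => /eqP/setP/(_ 0).
    by rewrite !inE mulr0 eqxx.
  move=> le_n hh Th; have [h1|h1] := eqVneq (1 - h) 0.
    by rewrite -[1](subrK h) h1 add0r.
  have [_ gg hg gh] := orthogonal_compl hh.
  have [e [ee e0 [ge eg] Le]] := exists_local_corner gg h1.
  have O : orthogonal e h.
    by split=> //; [rewrite -eg -mulrA gh mulr0 | rewrite -ge mulrA hg mul0r].
  have [k [kk [kh hk] ke Tk]] := two_good_extend_local O Le uu' vv' uv Th.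
  apply: (IH k) => //; rewrite -ltnS; apply: leq_trans le_n.
  apply: proper_card; apply/properP; split.
    apply/subsetP => x; rewrite !inE => /eqP <-; rewrite mulrA.
    by rewrite mulrBl mul1r mulrBr mulr1 hk subrr subr0.
  by exists e; rewrite !inE ?ge // mulrBl mul1r ke subrr eq_sym.
apply: (main #|[set x : R | (1 - 0) * x == x]| 0) => //; first by rewrite mulr0.
move=> x [<- _]; exists 0, 0; rewrite mul0r addr0; split=> //;
  apply: corner_unit_idem; exact: mulr0.
Qed.

End Finite.

Lemma right_inverse_unit (R : finUnitRingType) (x y : R) :
  x * y = 1 -> x \is a GRing.unit.
Proof.
move=> xy; have inj : injective (fun z => y * z).
  by move=> z w /(congr1 (fun r => x * r)); rewrite !mulrA xy !mul1r.
have [g _ yK] := injF_bij inj; have yz : y * g 1 = 1 := yK 1.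
have xz : x = g 1.
  by transitivity (x * (y * g 1)); [rewrite yz mulr1 | rewrite mulrA xy mul1r].
by apply/unitrP; exists y; split=> //; rewrite xz.
Qed.

Theorem corollary2p2 (R R' : finUnitRingType) (Phi : {rmorphism R -> R'}) :
  n_sum_property R 2 -> n_sum_property R' 2.
Proof.
move=> /(_ 1) [w [Uw]]; rewrite big_ord_recl big_ord1 => w1.
have inv i : Phi (w i) * Phi ((w i)^-1) = 1 by rewrite -rmorphM mulrV // rmorph1.
have uv : Phi (w ord0) + Phi (w (lift ord0 ord0)) = 1.
  by rewrite -rmorphD -w1 rmorph1.
move=> x; have Px : peirce 1 1 x by split; rewrite ?mul1r ?mulr1.
have [u [v [[_ [u' _ uu']] [_ [v' _ vv']] ->]]] := two_good1 (inv _) (inv _) uv Px.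
exists (fun i : 'I_2 => if i == ord0 then u else v); split.
  by move=> i; case: ifP => _;
     [exact: right_inverse_unit uu' | exact: right_inverse_unit vv'].
by rewrite big_ord_recl big_ord1.
Qed.
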